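(* Let $f:\mathbb{R}^d\to\mathbb{R}$ be continuously differentiable and satisfy $RC(\mu,\lambda)$ with local minimizer $\boldsymbol{x}_*$. The PID-damped accelerated gradient algorithm $$\boldsymbol{x}_{k+1}=(1+\beta)\boldsymbol{x}_k-\beta\boldsymbol{x}_{k-1}-(\alpha+\gamma)\nabla f(\boldsymbol{x}_k)+\gamma\nabla f(\boldsymbol{x}_{k-1}),\qquad k\ge0,$$ achieves linear convergence to $\boldsymbol{x}_*$ if the parameters $(\alpha,\beta,\gamma)$ belong to $\Omega=\Omega_u\cup\Omega_d$, where: 1) (over-damped region) $$\Omega_u=\left\{(\alpha,\beta,\gamma)\;\middle|\;\beta\in(-1,1),\ \max\{0,\mu\beta\}\le\gamma<\frac{\mu(1+\beta)}{1+\sqrt{1-\mu\lambda}},\ 0<\alpha<U(\beta,\gamma)\right\};$$ 2) (under-damped region) $$\Omega_d=\left\{(\alpha,\beta,\gamma)\;\middle|\;\beta\in(0,1),\ 0<\gamma<\mu\beta,\ 0<\alpha<U(\beta,\gamma),\ \Delta(\alpha)<0\right\}.$$ Here $$U(\beta,\gamma)=\frac{2(1+\beta)(1-\sqrt{1-\mu\lambda})}{\lambda}-2\gamma,\qquad\Delta(\alpha)=\Gamma_1^2-4\Gamma_2\Gamma_0,$$ with $$\begin{aligned}\Gamma_2&=4(\gamma-\mu\beta),\\ \Gamma_1&=2\lambda\gamma(\alpha+\gamma)-2(1+\beta)(\alpha+2\gamma)+2\mu(1+\beta)^2,\\ \Gamma_0&=-\lambda(\alpha^2+2\alpha\gamm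a+2\gamma^2)+2\alpha(1+\beta)+4\gamma\beta-2\mu(1+\beta^2).\end{aligned}$$
   Context: Regularity Condition: for constants $\mu,\lambda>0$ (necessarily $\mu\lambda\le1$), $f$ satisfies $RC(\mu,\lambda)$ with local minimizer $\boldsymbol{x}_*$ if $\langle\nabla f(\boldsymbol{x}),\boldsymbol{x}-\boldsymbol{x}_*\rangle\ge\frac{\mu}{2}\|\nabla f(\boldsymbol{x})\|^2+\frac{\lambda}{2}\|\boldsymbol{x}-\boldsymbol{x}_*\|^2$ for all $\boldsymbol{x}\in\mathbb{R}^d$. Linear convergence: with augmented state $\boldsymbol{\phi}_k=(\boldsymbol{x}_k,\boldsymbol{x}_{k-1},\nabla f(\boldsymbol{x}_{k-1}))\in\mathbb{R}^{3d}$ and $\boldsymbol{\phi}_*=(\boldsymbol{x}_*,\boldsymbol{x}_*,\mathbf{0})$, the algorithm achieves linear convergence to $\boldsymbol{x}_*$ if there exist constants $K\ge1$ and $\rho\in(0,1)$ such that, for all initial points $\boldsymbol{x}_0,\boldsymbol{x}_{-1}\in\mathbb{R}^d$ and all $k\ge0$, $\|\boldsymbol{\phi}_k-\boldsymbol{\phi}_*\|\le K\rho^k\|\boldsymbol{\phi}_0-\boldsymbol{\phi}_*\|$. *)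

(* Defs.v *)
From HB Require Import structures.
From mathcomp Require Import all_boot all_order all_algebra.
From mathcomp Require Import all_classical all_reals all_analysis.

Set Implicit Arguments.
Unset Strict Implicit.
Unset Printing Implicit Defensive.

Import Order.TTheory GRing.Theory Num.Theory.
Import numFieldNormedType.Exports.

Local Open Scope classical_set_scope.
Local Open Scope ring_scope.

(* The library norm `|x| on 'rV[R]_n is the sup norm, so the Euclidean inner
   product and norm are defined here. *)
Definition dotp (R : realType) (n : nat) (u v : 'rV[R]_n) : R :=
  \sum_(i < n) u 0 i * v 0 i.

Definition enorm (R : realType) (n : nat) (u : 'rV[R]_n) : R :=
  Num.sqrt (dotp u u).

Definition grad (R : realType) (d : nat) (f : 'rV[R]_d -> R) (x : 'rV[R]_d) :
  'rV[R]_d := \row_(j < d) 'D_(delta_mx 0 j) f x.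

(* Differentiability and continuity refer to the library topology of 'rV[R]_d,
   which is that of the sup norm and hence also the Euclidean one. *)
Definition continuously_differentiable (R : realType) (d : nat)
    (f : 'rV[R]_d -> R) : Prop :=
  (forall x, differentiable f x) /\ continuous (grad f).

Definition local_minimizer (R : realType) (d : nat) (f : 'rV[R]_d -> R)
    (xs : 'rV[R]_d) : Prop :=
  \forall y \near xs, f xs <= f y.

Definition RC (R : realType) (d : nat) (mu lambda : R) (f : 'rV[R]_d -> R)
    (xs : 'rV[R]_d) : Prop :=
  local_minimizer f xs /\
  forall x : 'rV[R]_d,
    mu / 2 * enorm (grad f x) ^+ 2 + lambda / 2 * enorm (x - xs) ^+ 2
      <= dotp (grad f x) (x - xs).

(* One step of the recursion, on pairs (x_k, x_{k-1}). *)
Definition pid_step (R : realType) (d : nat) (f : 'rV[R]_d -> R)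
    (alpha beta gamma : R) (p : 'rV[R]_d * 'rV[R]_d) : 'rV[R]_d * 'rV[R]_d :=
  ((1 + beta) *: p.1 - beta *: p.2
     - (alpha + gamma) *: grad f p.1 + gamma *: grad f p.2,
   p.1).

(* The pair (x_k, x_{k-1}) obtained from the initial points x_0 and x_{-1}. *)
Definition pid_iter (R : realType) (d : nat) (f : 'rV[R]_d -> R)
    (alpha beta gamma : R) (x0 xm1 : 'rV[R]_d) (k : nat) :
    'rV[R]_d * 'rV[R]_d :=
  iter k (pid_step f alpha beta gamma) (x0, xm1).

(* The augmented state (x_k, x_{k-1}, grad f (x_{k-1})) in R^{3d}, as a function
   of the pair p = (x_k, x_{k-1}). *)
Definition aug_state (R : realType) (d : nat) (f : 'rV[R]_d -> R)
    (p : 'rV[R]_d * 'rV[R]_d) : 'rV[R]_(d + d + d) :=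
  row_mx (row_mx p.1 p.2) (grad f p.2).

Definition aug_opt (R : realType) (d : nat) (xs : 'rV[R]_d) :
    'rV[R]_(d + d + d) :=
  row_mx (row_mx xs xs) 0.

(* [alg x0 xm1 k] is the pair (x_k, x_{k-1}) of consecutive iterates produced
   from the initial points x_0 and x_{-1}. *)
Definition linear_convergence (R : realType) (d : nat) (f : 'rV[R]_d -> R)
    (alg : 'rV[R]_d -> 'rV[R]_d -> nat -> 'rV[R]_d * 'rV[R]_d)
    (xs : 'rV[R]_d) : Prop :=
  exists K rho : R, [/\ 1 <= K, 0 < rho, rho < 1 &
    forall (x0 xm1 : 'rV[R]_d) (k : nat),
      enorm (aug_state f (alg x0 xm1 k) - aug_opt xs)
        <= K * rho ^+ k * enorm (aug_state f (alg x0 xm1 0%N) - aug_opt xs)].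

Definition stepU (R : realType) (mu lambda beta gamma : R) : R :=
  2 * (1 + beta) * (1 - Num.sqrt (1 - mu * lambda)) / lambda - 2 * gamma.

Definition Gamma2 (R : realType) (mu beta gamma : R) : R :=
  4 * (gamma - mu * beta).

Definition Gamma1 (R : realType) (mu lambda alpha beta gamma : R) : R :=
  2 * lambda * gamma * (alpha + gamma) - 2 * (1 + beta) * (alpha + 2 * gamma)
    + 2 * mu * (1 + beta) ^+ 2.

Definition Gamma0 (R : realType) (mu lambda alpha beta gamma : R) : R :=
  - lambda * (alpha ^+ 2 + 2 * alpha * gamma + 2 * gamma ^+ 2)
    + 2 * alpha * (1 + beta) + 4 * gamma * beta - 2 * mu * (1 + beta ^+ 2).

Definition Delta (R : realType) (mu lambda alpha beta gamma : R) : R :=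
  Gamma1 mu lambda alpha beta gamma ^+ 2
    - 4 * Gamma2 mu beta gamma * Gamma0 mu lambda alpha beta gamma.

(* Elements of the regions are triples (alpha, beta, gamma). *)
Definition Omega_u (R : realType) (mu lambda : R) : set (R * R * R) :=
  [set p : R * R * R | let: (alpha, beta, gamma) := p in
    [/\ -1 < beta < 1,
        Num.max 0 (mu * beta) <= gamma,
        gamma < mu * (1 + beta) / (1 + Num.sqrt (1 - mu * lambda)) &
        0 < alpha < stepU mu lambda beta gamma]].

Definition Omega_d (R : realType) (mu lambda : R) : set (R * R * R) :=
  [set p : R * R * R | let: (alpha, beta, gamma) := p in
    [/\ 0 < beta < 1,
        0 < gamma < mu * beta,
        0 < alpha < stepU mu lambda beta gamma &
        Delta mu lambda alpha beta gamma < 0]].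

Definition Omega (R : realType) (mu lambda : R) : set (R * R * R) :=
  Omega_u mu lambda `|` Omega_d mu lambda.

(* Main.v *)
Require Import Defs.
From HB Require Import structures.
From mathcomp Require Import all_boot all_order all_algebra.
From mathcomp Require Import all_classical all_reals all_analysis.
From mathcomp Require Import ring lra.
Import Order.TTheory GRing.Theory Num.Theory.
Import numFieldNormedType.Exports.
Local Open Scope classical_set_scope.
Local Open Scope ring_scope.

(** Why the theorem holds.  Write y_k = x_k - xs and u_k = grad f x_k.  The
recursion is a linear system driven by u, and the regularity condition is a
quadratic constraint between input and output at each time:
  sector y_k u_k = 2 <u_k, y_k> - mu |u_k|^2 - lambda |y_k|^2 >= 0.
With w_k = gamma u_{k-1} - beta y_{k-1} the system has the two-dimensional state
(y, w), since
  y_{k+1} = (1 + beta) y_k + w_k - (alpha + gamma) u_k,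
  w_{k+1} = gamma u_k - beta y_k.
System and constraint act on each coordinate of R^d separately, so it suffices
to find one quadratic form V(y, w) on R^2, positive definite, that satisfies the
dissipation inequality
  V(y_{k+1}, w_{k+1}) + sector y_k u_k + e (y_k^2 + w_k^2) <= V(y_k, w_k)
for all real y_k, w_k, u_k.  Summed over the coordinates, it makes V a Lyapunov
function that contracts by a constant factor at each step.

Existence of V.  From u to y the transfer function is -N/D, where
D(z) = (z - 1)(z - beta) and N(z) = (alpha + gamma) z - gamma.  For
z = exp(i theta) and c = cos theta, the sector form evaluated at u = D(z) and
y = - N(z) is Gamma2 c^2 + Gamma1 c + Gamma0.  The region Omega makes this
quadratic negative for all c in [-1, 1] ([frequency_gap]): in the over-damped
part it is convex and negative at both ends, in the under-damped part it is
concave with negative discriminant.  The passage from this frequency inequality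
to V (the Kalman-Yakubovich-Popov lemma) is explicit here: by the theorem of
Lukacs, a quadratic nonnegative on [-1, 1] is (p c + q)^2 + r (1 - c^2) with
r >= 0 ([lukacs_quadratic]); both terms are squared moduli of polynomials of
degree 2 on the unit circle, so the sector form is minus two squares up to a
telescoping term, and that term is V ([kyp_order2]).  The change of variables
behind this breaks down when N and D have a common root.  The root is then beta
and the system is gradient descent with step alpha + gamma, perturbed by a term
that decays like beta^k ([storage_uncontrollable]).

Positivity of V.  The gradient u = y / mu satisfies the sector constraint, and
the resulting linear recursion in (y, w) has bounded orbits
([schur_orbit_bounded]).  A form that strictly decreases along bounded orbits
cannot be negative anywhere ([nonneg_of_decrease]). *)

(** * Binary quadratic forms *)

Definition quad {R : realType} (A B C x y : R) : R :=
  A * x ^+ 2 + 2 * B * x * y + C * y ^+ 2.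

Lemma quad_linear_subst {R : realType} (A B C a b c d : R) :
  exists A' B' C' : R, forall x y,
    quad A' B' C' x y = quad A B C (a * x + b * y) (c * x + d * y).
Proof.
exists (quad A B C a c), (A * a * b + B * (a * d + b * c) + C * c * d),
  (quad A B C b d) => x y; by rewrite /quad; ring.
Qed.

Lemma quad_norm_le {R : realType} (A B C x y : R) :
  `|quad A B C x y| <= (`|A| + `|B| + `|C|) * (x ^+ 2 + y ^+ 2).
Proof.
have x2 := sqr_ge0 x; have y2 := sqr_ge0 y.
have xy : `|2 * x * y| <= x ^+ 2 + y ^+ 2.
  by rewrite ler_norml; have := sqr_ge0 (x + y); have := sqr_ge0 (x - y); lra.
have -> : quad A B C x y = A * x ^+ 2 + B * (2 * x * y) + C * y ^+ 2.
  by rewrite /quad; ring.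
have -> : (`|A| + `|B| + `|C|) * (x ^+ 2 + y ^+ 2) = `|A| * (x ^+ 2 + y ^+ 2)
  + `|B| * (x ^+ 2 + y ^+ 2) + `|C| * (x ^+ 2 + y ^+ 2) by ring.
rewrite (le_trans (ler_normD _ _)) // lerD //.
  rewrite (le_trans (ler_normD _ _)) // lerD // normrM ler_wpM2l //.
  by rewrite ger0_norm // lerDl.
by rewrite normrM ler_wpM2l // ger0_norm // lerDr.
Qed.

Lemma posdef_lower_bound (R : realType) (A B C : R) :
  0 < A -> B ^+ 2 < A * C ->
  exists2 m, 0 < m & forall x y, m * (x ^+ 2 + y ^+ 2) <= quad A B C x y.
Proof.
move=> A_gt0 detP.
have C_gt0 : 0 < C.
  by rewrite -(pmulr_rgt0 _ A_gt0); apply: le_lt_trans detP; apply: sqr_ge0.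
(* The determinant divided by the trace is a lower bound of both eigenvalues. *)
exists ((A * C - B ^+ 2) / (A + C)) => [|x y].
  by rewrite divr_gt0 ?subr_gt0 ?addr_gt0.
rewrite mulrAC ler_pdivrMr ?addr_gt0 // /quad -subr_ge0.
have := addr_ge0 (sqr_ge0 (A * x + B * y)) (sqr_ge0 (B * x + C * y)).
by congr (0 <= _); ring.
Qed.

(** * From a frequency inequality to a storage function *)

(** The three equations say that the quadratic is (p c + q)^2 + r (1 - c^2).
Its values at 1 and -1 are then (p + q)^2 and (p - q)^2, so p and q come from
the square roots of these values.  What remains is the sign of r.  It is clear
unless g0 < g2; then the quadratic is convex, its vertex lies in [-1, 1], and
nonnegativity there is the discriminant condition needed. *)
Lemma lukacs_quadratic (R : realType) (g2 g1 g0 : R) :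
  (forall c, -1 <= c <= 1 -> 0 <= g2 * c ^+ 2 + g1 * c + g0) ->
  exists p q r : R,
    [/\ 0 <= r, p ^+ 2 - r = g2, 2 * p * q = g1 & q ^+ 2 + r = g0].
Proof.
move=> g_ge0.
have gP : 0 <= g2 + g1 + g0 by have := g_ge0 1 ltac:(lra); lra.
have gN : 0 <= g2 - g1 + g0 by have := g_ge0 (-1) ltac:(lra); lra.
set a := Num.sqrt (g2 + g1 + g0); set b := Num.sqrt (g2 - g1 + g0).
have a_ge0 : 0 <= a := sqrtr_ge0 _.
have b_ge0 : 0 <= b := sqrtr_ge0 _.
have aE : a ^+ 2 = g2 + g1 + g0 by rewrite sqr_sqrtr.
have bE : b ^+ 2 = g2 - g1 + g0 by rewrite sqr_sqrtr.
exists ((a + b) / 2), ((a - b) / 2), (((a + b) / 2) ^+ 2 - g2).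
have rE : ((a + b) / 2) ^+ 2 - g2 = (g0 - g2 + a * b) / 2 by lra.
split; [| by lra..].
rewrite rE; suff : g2 - g0 <= a * b by lra.
have ab_ge0 : 0 <= a * b by apply: mulr_ge0.
case: (lerP g2 g0) => [|g02]; first by lra.
have g2_gt0 : 0 < g2 by lra.
rewrite -(@ler_pXn2r _ 2) ?nnegrE //; last by lra.
rewrite exprMn aE bE.
have vertex_in : -1 <= - g1 / (2 * g2) <= 1.
  by rewrite ler_pdivlMr ?ler_pdivrMr; lra.
have := g_ge0 _ vertex_in.
have -> : g2 * (- g1 / (2 * g2)) ^+ 2 + g1 * (- g1 / (2 * g2)) + g0
  = (4 * g2 * g0 - g1 ^+ 2) / (4 * g2) by field; rewrite gt_eqF.
rewrite ler_pdivlMr ?mul0r; last by lra.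
nra.
Qed.

(** The hypothesis says that the form is nonpositive on the complex vectors
(1, z, z^2) with |z| = 1, where c is the real part of z.  Adding the two squares
given by [lukacs_quadratic] makes it vanish there.  A form that vanishes on all
these vectors is a difference quad v0 v1 - quad v1 v2, because its coefficients
sum to zero along each diagonal. *)
Lemma kyp_order2 (R : realType) (s00 s11 s22 s01 s12 s02 : R) :
  (forall c, -1 <= c <= 1 ->
    s00 + s11 + s22 + 2 * (s01 + s12) * c + 2 * s02 * (2 * c ^+ 2 - 1) <= 0) ->
  exists A B C : R, forall v0 v1 v2,
    s00 * v0 ^+ 2 + s11 * v1 ^+ 2 + s22 * v2 ^+ 2
      + 2 * s01 * v0 * v1 + 2 * s12 * v1 * v2 + 2 * s02 * v0 * v2
      + quad A B C v1 v2 <= quad A B C v0 v1.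
Proof.
move=> symb.
have [c c11|p [q [r [r_ge0 Ep Epq Eq]]]] :=
  @lukacs_quadratic R (- 4 * s02) (- 2 * (s01 + s12))
    (2 * s02 - (s00 + s11 + s22)).
  by have := symb c c11; lra.
exists (s00 + p ^+ 2 / 4 + r / 4), (s01 + p * q / 2),
  (- (s22 + p ^+ 2 / 4 + r / 4)) => v0 v1 v2.
(* With c = cos theta and z = exp(i theta), p c + q and sin theta have the
   moduli of p (z^2 + 1) / 2 + q z and (z^2 - 1) / 2. *)
have l1 := sqr_ge0 (p * (v2 + v0) / 2 + q * v1).
have l2 : 0 <= r * ((v2 - v0) / 2) ^+ 2 by rewrite mulr_ge0 ?sqr_ge0.
have -> : s12 = - p * q - s01 by lra.
have -> : s02 = - (p ^+ 2 - r) / 4 by lra.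
have -> : s11 = - (q ^+ 2 + r) - s00 - s22 - (p ^+ 2 - r) / 2 by lra.
rewrite -subr_ge0 /quad; apply: le_trans (addr_ge0 l1 l2) _.
by rewrite le_eqVlt; apply/orP; left; apply/eqP; field.
Qed.

(** * Positivity of a decreasing form *)

(** Once V is negative on an orbit it stays below that value, so N stays bounded
away from 0 and V drops by a fixed amount at each step; but V is bounded below
on an orbit where N is bounded. *)
Lemma nonneg_of_decrease (R : realType) (T : Type) (F : T -> T) (V N : T -> R)
    (C e : R) :
  0 < C -> 0 < e ->
  (forall x, - C * N x <= V x) -> (forall x, V (F x) + e * N x <= V x) ->
  (forall x, exists b, forall n, N (iter n F x) <= b) ->
  forall x, 0 <= V x.
Proof.
move=> C_gt0 e_gt0 V_ge V_dec N_bnd x; rewrite leNgt; apply/negP => Vx.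
have [b Nb] := N_bnd x.
pose h := e * (- V x / C).
have h_gt0 : 0 < h by rewrite mulr_gt0 // divr_gt0 // oppr_gt0.
have Vn n : V (iter n F x) <= V x - h * n%:R.
  elim: n => [|n IH]; first by rewrite mulr0 subr0.
  have hn : 0 <= h * n%:R by rewrite mulr_ge0 // ltW.
  have : - V x / C <= N (iter n F x).
    by rewrite ler_pdivrMr //; have := V_ge (iter n F x); lra.
  rewrite -(ler_pM2l e_gt0) -/h iterS; have := V_dec (iter n F x).
  rewrite -natr1; lra.
have CN n : C * N (iter n F x) <= C * b by rewrite ler_pM2l.
have [n hn] : exists n : nat, C * b / h < n%:R.
  exists (Num.truncn (C * b / h)).+1; exact: truncnS_gt.
move: hn; rewrite ltr_pdivrMr //.
have := Vn n; have := V_ge (iter n F x); have := CN n; lra.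
Qed.

(** Boundedness needs an invariant: the Schur-Cohn form of the characteristic
polynomial z^2 - t z + d is positive definite under these (Jury) conditions, and
it changes by minus a square along the recursion. *)
Lemma schur_orbit_bounded (R : realType) (t d : R) :
  d < 1 -> t < 1 + d -> - t < 1 + d ->
  forall x : R * R, exists b, forall n,
    let z := iter n (fun x => (t * x.1 + x.2, - d * x.1)) x in
    z.1 ^+ 2 + z.2 ^+ 2 <= b.
Proof.
move=> d1 td tdN x; set F := (fun x : R * R => (_, _)).
(* The Schur-Cohn (Bezoutian) form of z^2 - t z + d, in the two consecutive
   values x.1 and t * x.1 + x.2 of the recursion. *)
pose W (x : R * R) := quad (1 - d ^+ 2) (- t * (1 - d)) (1 - d ^+ 2)
  (t * x.1 + x.2) x.1.
have W_dec z : W (F z) <= W z.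
  rewrite /W /F /quad -subr_ge0 /=.
  have := sqr_ge0 ((1 - d) * (t * (t * z.1 + z.2) - d * z.1 - z.1)).
  by congr (0 <= _); ring.
have [m m_gt0 Wm] : exists2 m, 0 < m & forall x y,
    m * (x ^+ 2 + y ^+ 2) <= quad (1 - d ^+ 2) (- t * (1 - d)) (1 - d ^+ 2) x y.
  apply: posdef_lower_bound; first by nra.
  have : 0 < (1 - d) ^+ 2 * ((1 + d - t) * (1 + d + t)).
    by rewrite mulr_gt0 ?exprn_gt0 ?mulr_gt0; lra.
  nra.
have WN z : z.1 ^+ 2 + z.2 ^+ 2 <= (3 + 2 * t ^+ 2) / m * W z.
  rewrite mulrAC ler_pdivlMr //.
  have := Wm (t * z.1 + z.2) z.1; rewrite -/(W z) => Wz.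
  apply: (@le_trans _ _ ((3 + 2 * t ^+ 2) *
    (m * ((t * z.1 + z.2) ^+ 2 + z.1 ^+ 2)))); last first.
    by apply: ler_wpM2l => //; have := sqr_ge0 t; lra.
  rewrite mulrCA mulrC ler_pM2l //.
  have := sqr_ge0 (2 * t * z.1 + z.2); have := sqr_ge0 (t * (t * z.1 + z.2)).
  have := sqr_ge0 (t * z.1); have := sqr_ge0 z.1; nra.
exists ((3 + 2 * t ^+ 2) / m * W x) => n /=.
apply: le_trans (WN _) _; apply: ler_wpM2l.
  by rewrite divr_ge0 ?ltW //; have := sqr_ge0 t; lra.
elim: n => //= n; apply: le_trans; exact: W_dec.
Qed.

(** * The storage function of the algorithm *)

Definition sector {R : realType} (mu lambda y u : R) : R :=
  2 * u * y - mu * u ^+ 2 - lambda * y ^+ 2.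

(** Dissipation inequality in the state (y, w) of the algorithm, with input u:
[quad A B C] loses at least the sector form and the supply rate in one step. *)
Definition storage {R : realType} (mu lambda alpha beta gamma : R)
    (supply : R -> R -> R -> R) (A B C : R) : Prop :=
  forall y w u,
    quad A B C ((1 + beta) * y + w - (alpha + gamma) * u) (gamma * u - beta * y)
      + sector mu lambda y u + supply y w u <= quad A B C y w.

Section Scalar.
Context {R : realType} (mu lambda alpha beta gamma : R).
Hypotheses (mu_gt0 : 0 < mu) (lambda_gt0 : 0 < lambda) (ml1 : mu * lambda <= 1).
Hypothesis params : Omega mu lambda (alpha, beta, gamma).

Lemma sqrt_one_minus_mul :
  0 <= Num.sqrt (1 - mu * lambda) /\
  Num.sqrt (1 - mu * lambda) ^+ 2 = 1 - mu * lambda.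
Proof. by split; [exact: sqrtr_ge0 | rewrite sqr_sqrtr // subr_ge0]. Qed.

Lemma Omega_bounds :
  [/\ -1 < beta, beta < 1, 0 <= gamma, 0 < alpha &
    lambda * (alpha + 2 * gamma)
      < 2 * (1 + beta) * (1 - Num.sqrt (1 - mu * lambda))].
Proof.
have stepP : alpha < stepU mu lambda beta gamma ->
    lambda * (alpha + 2 * gamma)
      < 2 * (1 + beta) * (1 - Num.sqrt (1 - mu * lambda)).
  by rewrite /stepU ltrBrDr ltr_pdivlMr // mulrC.
case: params => [] [].
  move=> /andP[b1 b2]; rewrite ge_max => /andP[g0 _] _ /andP[a0 aU].
  by split=> //; apply: stepP.
move=> /andP[b1 b2] /andP[g0 _] /andP[a0 aU] _.
by split; [lra|lra|lra| |apply: stepP].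
Qed.

(** With s = sqrt (1 - mu lambda), the factor (1 - s) / lambda in the bound on
alpha is mu / (1 + s) <= mu, since (1 - s)(1 + s) = mu lambda. *)
Lemma step_lt_mu : alpha + 2 * gamma < 2 * mu * (1 + beta).
Proof.
have [b1 _ _ _ aU] := Omega_bounds; have [s0 s2] := sqrt_one_minus_mul.
rewrite -(ltr_pM2l lambda_gt0); apply: lt_le_trans aU _.
set s := Num.sqrt _ in s0 s2 *.
have ml0 : 0 < mu * lambda by rewrite mulr_gt0.
have s1 : s <= 1 by nra.
have : 1 - s <= lambda * mu by nra.
by nra.
Qed.

(** At c = 1 the value is - lambda alpha^2, and the value at c = -1 is negative
by the upper bound on alpha.  A uniform gap m, not just strict negativity,
leaves room to perturb the sector form. *)
Lemma frequency_gap : exists2 m, 0 < m & forall c, -1 <= c <= 1 ->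
  Gamma2 mu beta gamma * c ^+ 2 + Gamma1 mu lambda alpha beta gamma * c
    + Gamma0 mu lambda alpha beta gamma <= - m.
Proof.
have [b1 b2 g0 a0 aU] := Omega_bounds; have [s0 s2] := sqrt_one_minus_mul.
set s := Num.sqrt _ in s0 s2 aU.
set G2 := Gamma2 _ _ _; set G1 := Gamma1 _ _ _ _ _; set G0 := Gamma0 _ _ _ _ _.
have at_one : G2 + G1 + G0 < 0.
  have : 0 < lambda * alpha ^+ 2 by rewrite mulr_gt0 ?exprn_gt0.
  by rewrite /G2 /G1 /G0 /Gamma2 /Gamma1 /Gamma0; lra.
(* Here lambda times the value is
   4 (1 + beta)^2 s^2 - (2 (1 + beta) - lambda t)^2 with t = alpha + 2 gamma. *)
have at_mone : G2 - G1 + G0 < 0.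
  rewrite -(pmulr_rlt0 _ lambda_gt0).
  have : (2 * (1 + beta) * s) ^+ 2
      < (2 * (1 + beta) - lambda * (alpha + 2 * gamma)) ^+ 2.
    have as_ge0 : 0 <= (1 + beta) * s by rewrite mulr_ge0; lra.
    by rewrite ltr_pXn2r ?nnegrE //; lra.
  rewrite exprMn s2 /G2 /G1 /G0 /Gamma2 /Gamma1 /Gamma0; lra.
have [G2ge0|G2lt0] := lerP 0 G2.
  exists (Num.min (- (G2 + G1 + G0)) (- (G2 - G1 + G0))) => [|c c11].
    by rewrite lt_min; apply/andP; split; lra.
  set m := Num.min _ _.
  have m1 : m <= - (G2 + G1 + G0) by rewrite /m ge_min lexx.
  have m2 : m <= - (G2 - G1 + G0) by rewrite /m ge_min lexx orbT.
  (* A convex function lies below the chord between c = -1 and c = 1. *)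
  have : 0 <= G2 * (1 - c ^+ 2) by rewrite mulr_ge0 //; nra.
  have : 0 <= (1 + c) * (- (G2 + G1 + G0) - m) by rewrite mulr_ge0; lra.
  have : 0 <= (1 - c) * (- (G2 - G1 + G0) - m) by rewrite mulr_ge0; lra.
  lra.
have D_lt0 : G1 ^+ 2 - 4 * G2 * G0 < 0.
  case: params => [] [] //.
  (* The over-damped region requires mu * beta <= gamma, that is G2 >= 0. *)
  rewrite ge_max => _ /andP[_ gb] _ _; exfalso; move: G2lt0.
  by rewrite /G2 /Gamma2; lra.
(* Minus the maximum of the concave quadratic, attained at its vertex. *)
exists ((G1 ^+ 2 - 4 * G2 * G0) / (4 * G2)) => [|c _].
  by rewrite -mulrNN -invrN divr_gt0; lra.
rewrite -mulrN -invrN ler_pdivlMr; last by lra.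
have := sqr_ge0 (2 * G2 * c + G1); lra.
Qed.

(** Image representation: a sequence v produces a trajectory of the system by
u = D(z) v and y = - N(z) v, with z the shift.  In terms of three consecutive
values, u = v2 - (1 + beta) v1 + beta v0 and y = gamma v0 - (alpha + gamma) v1,
and the state becomes (v0, v1), to which [kyp_order2] applies.  The map from
(v0, v1) to (y, w) has determinant N(1) N(beta), the quantity assumed nonzero,
so it can be inverted. *)
Lemma storage_controllable :
  alpha * (beta * (alpha + gamma) - gamma) != 0 ->
  exists A B C : R, exists2 e, 0 < e &
    storage mu lambda alpha beta gamma
      (fun y _ u => e * (y ^+ 2 + u ^+ 2)) A B C.
Proof.
set eta := alpha + gamma; set a := 1 + beta; move=> dt0.
set dt := alpha * (beta * eta - gamma) in dt0 *.
have [m m_gt0 gap] := frequency_gap.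
(* The form u^2 + y^2 at u = D(z), y = - N(z) is e2 c^2 + e1 c + e0. *)
pose e2 := 4 * beta; pose e1 := - 2 * a ^+ 2 - 2 * eta * gamma.
pose e0 := 2 + 2 * beta ^+ 2 + eta ^+ 2 + gamma ^+ 2.
pose M := 1 + `|e2| + `|e1| + `|e0|.
have M_gt0 : 0 < M.
  by rewrite /M -!addrA ltr_pwDl // !addr_ge0.
pose e := m / M.
have e_gt0 : 0 < e by rewrite divr_gt0.
have symb_bound c : -1 <= c <= 1 -> e * (e2 * c ^+ 2 + e1 * c + e0) <= m.
  move=> c11; rewrite /e mulrAC ler_pdivrMr // ler_pM2l //.
  have c1 : `|c| <= 1 by rewrite ler_norml; lra.
  rewrite (le_trans (ler_norm _)) // (le_trans (ler_normD _ _)) //.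
  rewrite /M lerD // (le_trans (ler_normD _ _)) // lerD //.
    rewrite normrM normrX (@le_trans _ _ `|e2|) ?lerDr // ler_piMr //.
    by rewrite exprn_ile1.
  by rewrite normrM ler_piMr.
pose m' := mu - e; pose l' := lambda - e.
(* The sector form plus e (y^2 + u^2), in terms of v0, v1 and v2. *)
have [|A [B [C HV]]] := @kyp_order2 R
  (2 * beta * gamma - m' * beta ^+ 2 - l' * gamma ^+ 2)
  (2 * a * eta - m' * a ^+ 2 - l' * eta ^+ 2)
  (- m')
  (- beta * eta - a * gamma + m' * a * beta + l' * eta * gamma)
  (- eta + m' * a)
  (gamma - m' * beta).
  move=> c c11; have := gap c c11; have := symb_bound c c11.
  rewrite /Gamma2 /Gamma1 /Gamma0 /e2 /e1 /e0 /m' /l' /a /eta; lra.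
(* (r y w, q y w) is the pair (v0, v1) that produces the state (y, w). *)
pose r y w := gamma / dt * y + eta / dt * w.
pose q y w := - (alpha * beta - gamma) / dt * y + gamma / dt * w.
have [A' [B' [C' E]]] := quad_linear_subst A B C (gamma / dt) (eta / dt)
  (- (alpha * beta - gamma) / dt) (gamma / dt).
exists A', B', C', e => // y w u; rewrite -/a -/eta.
have {}E y' w' : quad A' B' C' y' w' = quad A B C (r y' w') (q y' w').
  exact: E.
rewrite !E.
set v0 := r y w; set v1 := q y w; pose v2 := u - beta * v0 + a * v1.
have [? ?] : beta * eta - gamma != 0 /\ alpha != 0.
  by move: dt0; rewrite mulf_eq0 negb_or => /andP[].
have yE : y = gamma * v0 - eta * v1.
  by rewrite /v0 /v1 /r /q /dt /a /eta; field; apply/andP; split.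
have wE : w = (alpha * beta - gamma) * v0 + gamma * v1.
  by rewrite /v0 /v1 /r /q /dt /a /eta; field; apply/andP; split.
have uE : u = v2 + beta * v0 - a * v1 by rewrite /v2; ring.
have -> : r (a * y + w - eta * u) (gamma * u - beta * y) = v1.
  by rewrite yE wE uE /r /dt /a /eta; field; apply/andP; split.
have -> : q (a * y + w - eta * u) (gamma * u - beta * y) = v2.
  by rewrite yE wE uE /q /dt /a /eta; field; apply/andP; split.
have := HV v0 v1 v2; rewrite /sector yE uE /m' /l'; lra.
Qed.

(** As alpha > 0, the common root of N and D is beta, so gamma = beta eta with
eta = alpha + gamma.  Then z = beta y + w obeys z_{k+1} = beta z_k, and
y_{k+1} = y_k - eta u_k + z_k is gradient descent with a decaying disturbance.
The form is (y^2 + c z^2) / k with c large. *)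
Lemma storage_uncontrollable :
  alpha * (beta * (alpha + gamma) - gamma) = 0 ->
  exists A B C : R, exists2 e, 0 < e &
    storage mu lambda alpha beta gamma
      (fun y _ u => e * (y ^+ 2 + u ^+ 2)) A B C.
Proof.
have [b1 b2 g0 a0 aU] := Omega_bounds; have [s0 s2] := sqrt_one_minus_mul.
set s := Num.sqrt _ in s0 s2 aU; set eta := alpha + gamma.
move=> /eqP; rewrite mulf_eq0 gt_eqF //= subr_eq0 => /eqP cancel.
have eta_gt0 : 0 < eta by rewrite /eta; lra.
have step : 2 * s < 2 - lambda * eta.
  rewrite -(@ltr_pM2l _ (1 + beta)); last by lra.
  have tE : alpha + 2 * gamma = (1 + beta) * eta.
    by rewrite [RHS]mulrDl mul1r cancel /eta; ring.
  by move: aU; rewrite tE; lra.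
(* The determinant below is - k^2 s^2 + k eta (2 - lambda eta) - eta^2; this k
   turns it into eta^2 - (k s)^2. *)
pose k := 2 * eta / (2 - lambda * eta).
have k_gt0 : 0 < k by rewrite divr_gt0; lra.
have kE : k * (2 - lambda * eta) = 2 * eta by rewrite mulfVK // gt_eqF; lra.
have ks : k * s < eta by rewrite -(ltr_pM2l k_gt0) in step; lra.
(* The form is y^2 - (y - eta u)^2 - k sector: undisturbed descent contracts. *)
have [||m m_gt0 Hm] :=
  @posdef_lower_bound R (k * lambda) (eta - k) (k * mu - eta ^+ 2).
- by rewrite mulr_gt0.
- have : (k * s) ^+ 2 < eta ^+ 2.
    by rewrite ltr_pXn2r ?nnegrE //; [apply: mulr_ge0; lra | lra].
  rewrite exprMn s2; have : k * eta * (2 - lambda * eta) = 2 * eta ^+ 2.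
    by rewrite mulrAC kE; ring.
  lra.
(* Weight in the Young inequality: half of the gain m pays for the cross term,
   and c * z^2 pays for the disturbance. *)
pose th := m / (4 * (1 + eta ^+ 2)).
have eta2 : 0 < 1 + eta ^+ 2 by rewrite ltr_pwDl // sqr_ge0.
have th_gt0 : 0 < th by rewrite divr_gt0 // mulr_gt0.
have thE : th * (4 * (1 + eta ^+ 2)) = m.
  by rewrite mulfVK // gt_eqF // mulr_gt0.
pose c := (1 + th^-1) / (1 - beta ^+ 2).
have bb : 0 < 1 - beta ^+ 2 by nra.
have cE : c * (1 - beta ^+ 2) = 1 + th^-1 by rewrite mulfVK // gt_eqF.
exists ((1 + c * beta ^+ 2) / k), (c * beta / k), (c / k), (m / (2 * k)).
  by apply: divr_gt0; lra.
move=> y w u; rewrite -/eta.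
pose z := beta * y + w.
have E y' w' : quad ((1 + c * beta ^+ 2) / k) (c * beta / k) (c / k) y' w'
    = (y' ^+ 2 + c * (beta * y' + w') ^+ 2) / k by rewrite /quad; ring.
rewrite !E.
have -> : beta * ((1 + beta) * y + w - eta * u) + (gamma * u - beta * y)
    = beta * z.
  by rewrite /z -cancel; ring.
have -> : (1 + beta) * y + w - eta * u = (y - eta * u) + z by rewrite /z; ring.
rewrite -/z ler_pdivlMr // 2!mulrDl mulfVK ?gt_eqF //.
have -> : m / (2 * k) * (y ^+ 2 + u ^+ 2) * k = m / 2 * (y ^+ 2 + u ^+ 2).
  by field; rewrite gt_eqF.
have young : 2 * (y - eta * u) * z <= th * (y - eta * u) ^+ 2 + th^-1 * z ^+ 2.
  have : 0 <= th^-1 * (th * (y - eta * u) - z) ^+ 2.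
    by rewrite mulr_ge0 ?sqr_ge0 // invr_ge0 ltW.
  have -> : th^-1 * (th * (y - eta * u) - z) ^+ 2 = th * (y - eta * u) ^+ 2
    - 2 * (y - eta * u) * z + th^-1 * z ^+ 2 by field; rewrite gt_eqF.
  lra.
have small : th * (y - eta * u) ^+ 2 <= m / 2 * (y ^+ 2 + u ^+ 2).
  have -> : m / 2 * (y ^+ 2 + u ^+ 2)
    = th * (2 * (1 + eta ^+ 2) * (y ^+ 2 + u ^+ 2)) by rewrite -thE; field.
  rewrite ler_pM2l // -subr_ge0.
  have := addr_ge0 (addr_ge0 (sqr_ge0 (y + eta * u)) (sqr_ge0 u))
    (addr_ge0 (addr_ge0 (sqr_ge0 (eta * y)) (sqr_ge0 (eta * y))) (sqr_ge0 u)).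
  by have := sqr_ge0 (eta * u); nra.
have := Hm y u; rewrite /sector /quad.
have : c * z ^+ 2 = c * beta ^+ 2 * z ^+ 2 + (1 + th^-1) * z ^+ 2.
  by rewrite -cE; ring.
lra.
Qed.

Lemma storage_exists : exists A B C : R, exists2 e, 0 < e &
  storage mu lambda alpha beta gamma (fun y _ u => e * (y ^+ 2 + u ^+ 2)) A B C.
Proof.
case: (eqVneq (alpha * (beta * (alpha + gamma) - gamma)) 0).
  exact: storage_uncontrollable.
exact: storage_controllable.
Qed.

(** The closed loop u = y / mu makes the sector form nonnegative, so the storage
function decreases strictly along it, and its orbits are bounded. *)
Lemma storage_posdef (A B C h : R) : 0 < h ->
  storage mu lambda alpha beta gamma
    (fun y w _ => h * (y ^+ 2 + w ^+ 2)) A B C ->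
  forall y w, h * (y ^+ 2 + w ^+ 2) <= quad A B C y w.
Proof.
move=> h_gt0 dec.
have [b1 b2 g0 a0 _] := Omega_bounds; have stepP := step_lt_mu.
have mu_neq0 : mu != 0 by rewrite gt_eqF.
(* Trace and determinant of the closed loop u = y / mu. *)
pose t := 1 + beta - (alpha + gamma) / mu; pose d := beta - gamma / mu.
pose F (x : R * R) := (t * x.1 + x.2, - d * x.1).
have decF x : quad A B C (F x).1 (F x).2 + h * (x.1 ^+ 2 + x.2 ^+ 2)
    <= quad A B C x.1 x.2.
  have := dec x.1 x.2 (x.1 / mu).
  have -> : sector mu lambda x.1 (x.1 / mu) = (1 - mu * lambda) / mu * x.1 ^+ 2.
    by rewrite /sector; field.
  have : 0 <= (1 - mu * lambda) / mu * x.1 ^+ 2.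
    by rewrite mulr_ge0 ?sqr_ge0 // divr_ge0 ?subr_ge0 // ltW.
  have -> : (1 + beta) * x.1 + x.2 - (alpha + gamma) * (x.1 / mu) = (F x).1.
    by rewrite /F /t /=; ring.
  have -> : gamma * (x.1 / mu) - beta * x.1 = (F x).2.
    by rewrite /F /d /=; ring.
  lra.
have V_ge0 x : 0 <= quad A B C x.1 x.2.
  pose N (x : R * R) := x.1 ^+ 2 + x.2 ^+ 2.
  pose K := 1 + `|A| + `|B| + `|C|.
  have K_gt0 : 0 < K by rewrite /K -!addrA ltr_pwDl // !addr_ge0.
  apply: (@nonneg_of_decrease R (R * R)%type F
    (fun x => quad A B C x.1 x.2) N K h) => // {x} x.
    have := quad_norm_le A B C x.1 x.2; rewrite ler_norml => /andP[+ _].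
    by have := addr_ge0 (sqr_ge0 x.1) (sqr_ge0 x.2); rewrite /K /N; lra.
  apply: schur_orbit_bounded.
  - have : 0 <= gamma / mu by rewrite divr_ge0 // ltW.
    by rewrite /d; lra.
  - have : 0 < alpha / mu by rewrite divr_gt0.
    by rewrite /d /t; lra.
  - have : (alpha + 2 * gamma) / mu < 2 * (1 + beta).
      by rewrite ltr_pdivrMr //; lra.
    by rewrite /d /t; lra.
by move=> y w; have := decF (y, w); have := V_ge0 (F (y, w)) => /=; lra.
Qed.

(** A term h w^2 added to the form supplies the missing coercivity in w: its
value after the step is at most a multiple of y^2 + u^2, which the existing
supply absorbs. *)
Lemma strict_storage_exists : exists A B C e : R,
  [/\ 0 < e,
    storage mu lambda alpha beta gamma
      (fun y w _ => e * (y ^+ 2 + w ^+ 2)) A B C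
    & forall y w, e * (y ^+ 2 + w ^+ 2) <= quad A B C y w].
Proof.
have [A [B [C [e e_gt0 HV]]]] := storage_exists.
pose M := 2 * (beta ^+ 2 + gamma ^+ 2).
have M_ge0 : 0 <= M by rewrite mulr_ge0 // addr_ge0 ?sqr_ge0.
pose h := e / (2 + M).
have M2 : 0 < 2 + M by lra.
have h_gt0 : 0 < h by rewrite divr_gt0.
have hE : h * (2 + M) = e by rewrite mulfVK // gt_eqF.
have dec : storage mu lambda alpha beta gamma
    (fun y w _ => h * (y ^+ 2 + w ^+ 2)) A B (C + h).
  move=> y w u.
  have := HV y w u.
  have : h * (gamma * u - beta * y) ^+ 2 <= h * (M * (y ^+ 2 + u ^+ 2)).
    rewrite ler_pM2l // -subr_ge0.
    have := addr_ge0 (sqr_ge0 (gamma * u + beta * y))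
      (addr_ge0 (sqr_ge0 (gamma * y)) (sqr_ge0 (beta * u))).
    by have := sqr_ge0 (gamma * y); have := sqr_ge0 (beta * u); rewrite /M; lra.
  have : 0 <= h * (y ^+ 2 + u ^+ 2).
    by rewrite mulr_ge0 ?addr_ge0 ?sqr_ge0 // ltW.
  have : 0 <= h * u ^+ 2 by rewrite mulr_ge0 ?sqr_ge0 // ltW.
  rewrite -hE /quad; lra.
exists A, B, (C + h), h; split=> //; exact: storage_posdef.
Qed.

End Scalar.

(** * Consequences of the regularity condition *)

Lemma dotp_ge0 {R : realType} {n : nat} (u : 'rV[R]_n) : 0 <= dotp u u.
Proof. by apply: sumr_ge0 => i _; rewrite -expr2 sqr_ge0. Qed.

Lemma enorm_sqr {R : realType} {n : nat} (u : 'rV[R]_n) :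
  enorm u ^+ 2 = dotp u u.
Proof. by rewrite sqr_sqrtr ?dotp_ge0. Qed.

Lemma dotp_row_mx {R : realType} {m n : nat} (u1 v1 : 'rV[R]_m)
    (u2 v2 : 'rV[R]_n) :
  dotp (row_mx u1 u2) (row_mx v1 v2) = dotp u1 v1 + dotp u2 v2.
Proof.
rewrite /dotp big_split_ord; congr (_ + _); apply: eq_bigr => i _.
  by rewrite !row_mxEl.
by rewrite !row_mxEr.
Qed.

Section Regularity.
Context {R : realType} {d : nat} (mu lambda : R) (f : 'rV[R]_d -> R)
  (xs : 'rV[R]_d).
Hypotheses (mu_gt0 : 0 < mu) (lambda_gt0 : 0 < lambda).
Hypothesis f_RC : RC mu lambda f xs.

Lemma RC_sector x :
  0 <= \sum_(i < d) sector mu lambda ((x - xs) 0 i) (grad f x 0 i).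
Proof.
have [_ /(_ x)] := f_RC; rewrite !enorm_sqr => H.
have -> : \sum_(i < d) sector mu lambda ((x - xs) 0 i) (grad f x 0 i)
  = 2 * (dotp (grad f x) (x - xs) - mu / 2 * dotp (grad f x) (grad f x)
     - lambda / 2 * dotp (x - xs) (x - xs)).
  rewrite /dotp 2!mulr_sumr -2!sumrB mulr_sumr; apply: eq_bigr => i _.
  by rewrite /sector; field.
by lra.
Qed.

Lemma RC_grad_bound x :
  dotp (grad f x) (grad f x) <= 4 / mu ^+ 2 * dotp (x - xs) (x - xs).
Proof.
rewrite mulrAC ler_pdivlMr ?exprn_gt0 // [_ * mu ^+ 2]mulrC -subr_ge0.
apply: le_trans (mulr_ge0 (ltW mu_gt0) (RC_sector x)) _.
apply: (@le_trans _ _ (2 * (mu * \sum_(i < d)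
    sector mu lambda ((x - xs) 0 i) (grad f x 0 i)))).
  by have := mulr_ge0 (ltW mu_gt0) (RC_sector x); lra.
rewrite /dotp !mulr_sumr -sumrB; apply: ler_sum => i _.
set u := grad f x 0 i; set y := (x - xs) 0 i; rewrite /sector.
have := sqr_ge0 (mu * u - 2 * y); have := sqr_ge0 y.
have : 0 <= mu * lambda * y ^+ 2.
  by rewrite mulr_ge0 ?sqr_ge0 // mulr_ge0 // ltW.
lra.
Qed.

(** The regularity condition at any point other than xs forces mu lambda <= 1;
such a point exists as soon as d > 0. *)
Lemma RC_condition_number (i : 'I_d) : mu * lambda <= 1.
Proof.
have H := mulr_ge0 (ltW mu_gt0) (RC_sector (xs + delta_mx 0 i)).
move: H; rewrite addrC addKr mulr_sumr => H.
have : 0 <= \sum_(j < d) (1 - mu * lambda) * (delta_mx 0 i : 'rV[R]_d) 0 j ^+ 2.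
  apply: le_trans H _; apply: ler_sum => j _; rewrite /sector.
  set u := grad f _ 0 j; set y := delta_mx _ _ _ _.
  by have := sqr_ge0 (mu * u - y); lra.
rewrite (bigD1 i) //= big1 => [|j ji]; last first.
  by rewrite mxE eqxx (negbTE ji) expr0n mulr0.
by rewrite mxE !eqxx expr1n mulr1 addr0 subr_ge0.
Qed.

End Regularity.

(** * Linear convergence *)

Lemma dotp_aug_state {R : realType} {d : nat} (f : 'rV[R]_d -> R)
    (xs : 'rV[R]_d) p :
  dotp (aug_state f p - aug_opt xs) (aug_state f p - aug_opt xs)
  = dotp (p.1 - xs) (p.1 - xs) + dotp (p.2 - xs) (p.2 - xs)
    + dotp (grad f p.2) (grad f p.2).
Proof.
by rewrite /aug_state /aug_opt !opp_row_mx !add_row_mx !dotp_row_mx subr0.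
Qed.

(** Squared norms that decay like tau^k give the rate sqrt tau.  The index shift
is harmless, as it only multiplies the constant by 1 / tau. *)
Lemma linear_convergence_of_sqr_decay (R : realType) (d : nat)
    (f : 'rV[R]_d -> R) alg (xs : 'rV[R]_d) (M tau : R) :
  let E x0 xm1 k :=
    dotp (aug_state f (alg x0 xm1 k) - aug_opt xs)
         (aug_state f (alg x0 xm1 k) - aug_opt xs) in
  0 < tau < 1 ->
  (forall x0 xm1 k, E x0 xm1 k.+1 <= M * tau ^+ k * E x0 xm1 0%N) ->
  linear_convergence f alg xs.
Proof.
move=> E /andP[tau_gt0 tau_lt1] decay.
pose K2 := 1 + `|M| / tau.
have K2_ge0 : 0 <= K2 by rewrite addr_ge0 // divr_ge0 // ltW.
exists (Num.sqrt K2), (Num.sqrt tau); split.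
- by rewrite -[1]sqrtr1 ler_sqrt ?lerDl // divr_ge0 // ltW.
- by rewrite sqrtr_gt0.
- by rewrite -[1]sqrtr1 ltr_sqrt.
move=> x0 xm1 k; rewrite /enorm -/(E _ _ _) -/(E _ _ _).
have E_ge0 : 0 <= E x0 xm1 0%N by exact: dotp_ge0.
have tk_ge0 n : 0 <= tau ^+ n by rewrite exprn_ge0 // ltW.
rewrite -(ler_pXn2r (ltn0Sn 1)) ?nnegrE ?mulr_ge0 ?exprn_ge0 ?sqrtr_ge0 //.
have -> : (Num.sqrt K2 * Num.sqrt tau ^+ k * Num.sqrt (E x0 xm1 0%N)) ^+ 2
    = K2 * tau ^+ k * E x0 xm1 0%N.
  by rewrite 2!exprMn -exprM mulnC exprM !sqr_sqrtr // ltW.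
rewrite sqr_sqrtr; last exact: dotp_ge0.
case: k => [|k].
  by rewrite expr0 mulr1 ler_peMl // lerDl divr_ge0 // ltW.
apply: le_trans (decay x0 xm1 k) _; apply: ler_wpM2r => //.
have -> : K2 * tau ^+ k.+1 = (tau + `|M|) * tau ^+ k.
  by rewrite exprS mulrA mulrDl mul1r divfK ?gt_eqF.
by apply: ler_wpM2r => //; rewrite (le_trans (ler_norm M)) // lerDr ltW.
Qed.

Theorem theorem3 (R : realType) (d : nat) (mu lambda : R)
    (f : 'rV[R]_d -> R) (xs : 'rV[R]_d) (alpha beta gamma : R)
    (mu_gt0 : 0 < mu) (lambda_gt0 : 0 < lambda)
    (f_C1 : continuously_differentiable f)
    (f_RC : RC mu lambda f xs)
    (params : Omega mu lambda (alpha, beta, gamma)) :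
  linear_convergence f (pid_iter f alpha beta gamma) xs.
Proof.
have [ml1|ml_gt1] := lerP (mu * lambda) 1; last first.
  (* Only the zero-dimensional space is compatible with 1 < mu * lambda. *)
  case: d f xs f_C1 f_RC => [|d] f xs _ f_RC; last first.
    have := RC_condition_number mu lambda f xs mu_gt0 f_RC ord0.
    by rewrite leNgt ml_gt1.
  apply: (@linear_convergence_of_sqr_decay _ _ _ _ _ 0 (1 / 2)); first by lra.
  by move=> x0 xm1 k; rewrite dotp_aug_state /dotp !big_ord0 !addr0 !mul0r.
have [A [B [C [e [e_gt0 dec V_ge]]]]] :=
  strict_storage_exists mu lambda alpha beta gamma mu_gt0 lambda_gt0 ml1 params.
pose y (p : 'rV[R]_d * 'rV[R]_d) i := (p.1 - xs) 0 i.
pose w (p : 'rV[R]_d * 'rV[R]_d) i :=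
  gamma * grad f p.2 0 i - beta * (p.2 - xs) 0 i.
pose V p := \sum_(i < d) quad A B C (y p i) (w p i).
pose N p := \sum_(i < d) (y p i ^+ 2 + w p i ^+ 2).
pose E p := dotp (aug_state f p - aug_opt xs) (aug_state f p - aug_opt xs).
pose step := pid_step f alpha beta gamma.
have N_ge0 p : 0 <= N p by apply: sumr_ge0 => i _; rewrite addr_ge0 ?sqr_ge0.
have E_ge0 p : 0 <= E p by exact: dotp_ge0.
have NV p : e * N p <= V p.
  by rewrite mulr_sumr; apply: ler_sum => i _; exact: V_ge.
(* The summand 1 + e makes e / K < 1 below. *)
pose K := 1 + e + (`|A| + `|B| + `|C|).
have K_gt0 : 0 < K by rewrite /K -addrA ltr_pwDl // !addr_ge0 // ltW.
have VN p : V p <= K * N p.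
  rewrite mulr_sumr; apply: ler_sum => i _.
  apply: le_trans (ler_norm _) (le_trans (quad_norm_le _ _ _ _ _) _).
  by rewrite ler_wpM2r ?addr_ge0 ?sqr_ge0 // /K lerDr addr_ge0 // ltW.
have V_step p : V (step p) + e * N p <= V p.
  have Vs : V (step p) + \sum_(i < d) sector mu lambda (y p i) (grad f p.1 0 i)
      + e * N p <= V p.
    rewrite mulr_sumr -!big_split; apply: ler_sum => i _ /=.
    apply: le_trans (dec (y p i) (w p i) (grad f p.1 0 i)).
    rewrite le_eqVlt; apply/orP; left; apply/eqP; congr (_ + _ + _).
    by congr quad; rewrite /y /w /step /pid_step /= !mxE; ring.
  by have := RC_sector mu lambda f xs f_RC p.1; rewrite -/(y p _); lra.
pose tau := 1 - e / K.
have eK : e / K < 1 by rewrite ltr_pdivrMr // /K mul1r;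
  have := normr_ge0 A; have := normr_ge0 B; have := normr_ge0 C; lra.
have tauP : 0 < tau < 1.
  by have : 0 < e / K by [rewrite divr_gt0]; rewrite /tau; lra.
have V_contract p : V (step p) <= tau * V p.
  have : e / K * V p <= e * N p.
    by rewrite mulrAC ler_pdivrMr // -mulrA ler_pM2l // mulrC.
  by have := V_step p; rewrite /tau; lra.
have V_iter p k : V (iter k step p) <= tau ^+ k * V p.
  elim: k => [|k IH]; first by rewrite mul1r.
  rewrite iterS exprS -mulrA; apply: le_trans (V_contract _) _.
  by rewrite ler_pM2l //; case/andP: tauP.
pose M1 := 1 + 2 * beta ^+ 2 + 2 * gamma ^+ 2.
have NE p : N p <= M1 * E p.
  rewrite /E dotp_aug_state /dotp -!big_split mulr_sumr; apply: ler_sum => i _.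
  rewrite /y /w /=; set a := (p.1 - xs) 0 i; set b := (p.2 - xs) 0 i.
  set u := grad f p.2 0 i; rewrite /M1.
  have := sqr_ge0 (gamma * u + beta * b).
  have := sqr_ge0 (gamma * a); have := sqr_ge0 (gamma * b).
  have := sqr_ge0 (beta * a); have := sqr_ge0 (beta * u).
  by have := sqr_ge0 b; have := sqr_ge0 u; lra.
pose M2 := 1 + 4 / mu ^+ 2.
have M2_ge0 : 0 <= M2 by rewrite addr_ge0 // divr_ge0 ?sqr_ge0.
have dotN p : dotp (p.1 - xs) (p.1 - xs) <= N p.
  by apply: ler_sum => i _; rewrite -expr2 lerDl sqr_ge0.
(* The size N p of the state bounds the older point and its gradient only after
   one more step, when they are p.1 and grad f p.1. *)
have E_step p : E (step p) <= N (step p) + M2 * N p.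
  rewrite /E dotp_aug_state -addrA; apply: lerD; first exact: dotN.
  apply: le_trans (ler_wpM2l M2_ge0 (dotN p)).
  rewrite [step p]/= [_.2]/= /M2 mulrDl mul1r lerD2l.
  exact: RC_grad_bound f_RC _.
apply: (@linear_convergence_of_sqr_decay _ _ _ _ _
  ((1 + M2) / e * (K * M1)) tau) => // x0 xm1 k.
rewrite /pid_iter iterS -/step -/(E _) -/(E _) /=.
set p := (x0, xm1); set pk := iter k step p.
have Nle q : V q <= tau ^+ k * V p -> N q <= (tau ^+ k * V p) / e.
  by move=> Vq; rewrite ler_pdivlMr // mulrC; apply: le_trans (NV q) Vq.
have Vk1 : V (step pk) <= tau ^+ k * V p.
  apply: le_trans (V_iter p k); have := V_step pk.
  by have := mulr_ge0 (ltW e_gt0) (N_ge0 pk); rewrite -/pk; lra.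
apply: (@le_trans _ _ ((1 + M2) * ((tau ^+ k * V p) / e))).
  apply: le_trans (E_step pk) _; rewrite [leRHS]mulrDl mul1r; apply: lerD.
    exact: Nle.
  by apply: ler_wpM2l => //; apply: Nle; exact: V_iter.
have -> : (1 + M2) / e * (K * M1) * tau ^+ k * E p
  = (1 + M2) * ((tau ^+ k * (K * (M1 * E p))) / e) by ring.
apply: ler_wpM2l; first by rewrite addr_ge0.
rewrite ler_pM2r ?invr_gt0 //; apply: ler_wpM2l.
  by rewrite exprn_ge0 //; case/andP: tauP => /ltW.
by apply: le_trans (VN p) _; rewrite ler_pM2l.
Qed.
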